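(* Let $(X,d)$ be a complete separable metric space, let $(\Xi,\mathcal{A},\mathbb{P})$ be a complete probability space, let $M:\Xi\rightrightarrows X$ be a measurable multifunction with closed values, and let $T:\Xi\to\Xi$ be an ergodic measure preserving transformation. Let $g:X\to\mathbb{R}\cup\{+\infty\}$ be lower semicontinuous, and let $g_n:X\to\mathbb{R}\cup\{+\infty\}$, $n\in\mathbb{N}$, be lower semicontinuous functions converging continuously to $g$. Put $M_{as}:=\{x\in X: x\in M(\xi)\text{ for }\mathbb{P}\text{-almost every }\xi\}$ and $E_n(\xi):=\bigcap_{k=1}^nM(T^k(\xi))$ for $\xi\in\Xi$, $n\geq 1$. Assume that the problem of minimizing $g$ over $M_{as}$ is feasible (there is $x\in M_{as}$ with $g(x)<+\infty$), and that for $\mathbb{P}$-almost every $\xi\in\Xi$ the sequence $(g_n)$ is eventually level-compact on $(E_n(\xi))_n$. Then: (a) $\lim_{n\to\infty}v(g_n,E_n(\xi))=v(g,M_{as})$ for $\mathbb{P}$-almost every $\xi$. (b) For any sequence of measurable functions $\epsilon_n:\Xi\to(0,+\infty)$ with $\epsilon_n(\xi)\to0$ for $\mathbb{P}$-almost every $\xi$, $$\emptyset\neq\limsup_{n\to\infty}\ \epsilon_n(\xi)\text{-}\mathrm{argmin}_{E_n(\xi)}\,g_n\subseteq\mathrm{argmin}_{M_{as}}\,g\quad\text{for }\mathbb{P}\text{-almost every }\xi.$$ (c) For $\mathbb{P}$-almost every $\xi$, $$\bigcap_{\epsilon>0}\liminf_{n\to\infty}\ \epsilon\text{-}\mathrm{argmin}_{E_n(\xi)}\,g_n=\mathrm{argmin}_{M_{as}}\,g=\bigcap_{\epsilon>0}\limsup_{n\to\infty}\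 \epsilon\text{-}\mathrm{argmin}_{E_n(\xi)}\,g_n.$$
   Context: A multifunction $M:\Xi\rightrightarrows X$ assigns to each $\xi$ a subset $M(\xi)\subseteq X$; it is measurable if $\{\xi\in\Xi: M(\xi)\cap U\ne\emptyset\}\in\mathcal{A}$ for every open $U\subseteq X$. A measurable map $T:\Xi\to\Xi$ is measure preserving if $\mathbb{P}(T^{-1}(A))=\mathbb{P}(A)$ for all $A\in\mathcal{A}$; it is ergodic if for all $A\in\mathcal{A}$, $A=T^{-1}(A)$ implies $\mathbb{P}(A)=0$ or $\mathbb{P}(A^c)=0$. An ergodic measure preserving transformation is a measurable map satisfying both. $T^k$ is the $k$-fold composition of $T$. Functions $h_n:X\to\mathbb{R}\cup\{+\infty\}$ converge continuously to $h$ if $\lim_n h_n(x_n)=h(x)$ for every $x\in X$ and every sequence $x_n\to x$. A sequence of functions $h_n$ is eventually level-compact on a sequence of sets $C_n\subseteq X$ if for each $\alpha\in\mathbb{R}$ there is $n_\alpha\in\mathbb{N}$ such that $\bigcup_{n\ge n_\alpha}\{x\in C_n: h_n(x)\le\alpha\}$ is relatively compact. For $h:X\to\mathbb{R}\cup\{+\infty\}$, $C\subseteq X$ and $\epsilon\ge0$: $v_\epsilon(h,C):=\inf_C h+\epsilon$ if $\inf_C h>-\infty$, and $v_\epsilon(h,C):=-1/\epsilon$ if $\inf_C h=-\infty$, with the convention $1/0=+\infty$; $\epsilon\text{-}\mathrm{argmin}_C\,h:=\{x\in C:h(x)\le v_\epsilon(h,C)\}$. When $\epsilon=0$ the symbol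 $\epsilon$ is omitted: $v(h,C)=\inf_C h$ and $\mathrm{argmin}_C\,h=\{x\in C:h(x)\le\inf_C h\}$. For sets $S_n\subseteq X$, the Painlevé–Kuratowski limits are $\liminf_{n\to\infty}S_n:=\{x\in X:\limsup_{n\to\infty}d(x,S_n)=0\}$ and $\limsup_{n\to\infty}S_n:=\{x\in X:\liminf_{n\to\infty}d(x,S_n)=0\}$, where $d(x,S_n)=\inf\{d(x,y):y\in S_n\}$ and $\inf\emptyset=+\infty$. *)

(* Defs.v *)
From HB Require Import structures.
From mathcomp Require Import all_boot all_order all_algebra.
From mathcomp Require Import all_classical all_reals all_analysis.

Set Implicit Arguments.
Unset Strict Implicit.
Unset Printing Implicit Defensive.

Import Order.TTheory GRing.Theory Num.Theory.
Import numFieldNormedType.Exports.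

Local Open Scope classical_set_scope.
Local Open Scope ring_scope.
Local Open Scope ereal_scope.

#[short(type="completeMetricType")]
HB.structure Definition CompleteMetric (K : numDomainType) :=
  {X of Metric K X & Complete X}.

Definition separable (X : topologicalType) : Prop :=
  exists2 D : set X, countable D & dense D.

Definition measurable_multifunction (d : measure_display)
    (Xi : measurableType d) (X : topologicalType) (M : Xi -> set X) : Prop :=
  forall U : set X, open U -> measurable [set xi | M xi `&` U !=set0].

Section ergodic.
Context (d : measure_display) (Xi : measurableType d) (R : realType).
Variable P : probability Xi R.

Definition measure_preserving (T : Xi -> Xi) : Prop :=
  measurable_fun [set: Xi] T /\
  forall A, measurable A -> P (T @^-1` A) = P A.

Definition ergodic (T : Xi -> Xi) : Prop :=
  measurable_fun [set: Xi] T /\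
  forall A, measurable A -> A = T @^-1` A -> P A = 0 \/ P (~` A) = 0.

End ergodic.

Section variational.
Context (R : realType) (X : metricType R).
Implicit Types (h : X -> \bar R) (C : set X) (e : R) (S : (set X)^nat).

(* Functions into R u {+oo} are functions into \bar R avoiding -oo *)
Definition no_ninfty h : Prop := forall x, -oo < h x.

Definition converges_continuously (h_ : nat -> X -> \bar R) h : Prop :=
  forall (x : X) (x_ : nat -> X),
    x_ @ \oo --> x -> h_ n (x_ n) @[n --> \oo] --> h x.

Definition eventually_level_compact (h_ : nat -> X -> \bar R) S : Prop :=
  forall a : R, exists n_a : nat,
    precompact (\bigcup_(n in [set n | (n_a <= n)%N])
      [set x | S n x /\ h_ n x <= a%:E]).

Definition inf_on h C : \bar R := ereal_inf (h @` C).

(* The inverse is the one of \bar R, for which 0^-1 = +oo *)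
Definition eps_val e h C : \bar R :=
  if inf_on h C == -oo then - e%:E^-1 else inf_on h C + e%:E.

Definition eps_argmin e h C : set X := [set x | C x /\ h x <= eps_val e h C].

Definition val_min h C : \bar R := eps_val 0 h C.

Definition argmin h C : set X := eps_argmin 0 h C.

Lemma val_minE h C : val_min h C = inf_on h C.
Proof.
by rewrite /val_min /eps_val; case: eqP => [->|_]; rewrite ?inve0 ?adde0.
Qed.

Lemma argminE h C : argmin h C = [set x | C x /\ h x <= inf_on h C].
Proof. by rewrite -val_minE. Qed.

(* \bar R-valued, so that the distance to the empty set is +oo *)
Definition dist_to (x : X) C : \bar R := ereal_inf [set (mdist x y)%:E | y in C].

Definition pk_liminf S : set X :=
  [set x | limn_esup (fun n => dist_to x (S n)) = 0].

Definition pk_limsup S : set X :=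
  [set x | limn_einf (fun n => dist_to x (S n)) = 0].

End variational.

Section sampled_problem.
Context (d : measure_display) (Xi : measurableType d) (R : realType).
Context (X : Type) (M : Xi -> set X).

Definition almost_sure_set (P : probability Xi R) : set X :=
  [set x | \forall xi \ae P, M xi x].

(* The value at n = 0 is the whole space; only n >= 1 is meaningful *)
Definition sampled_set (T : Xi -> Xi) (xi : Xi) (n : nat) : set X :=
  \bigcap_(k in [set k | (1 <= k <= n)%N]) M (iter k T xi).

End sampled_problem.

(* Main.v *)
Require Import Defs.
From mathcomp Require Import all_boot all_order all_algebra.
From mathcomp Require Import all_classical all_reals all_analysis.
From mathcomp Require Import lra.

(* Let C be the closed set M_as. Almost surely the decreasing closed sets E_n
   have intersection C. Indeed a countable dense subset of C lies in almost
   every M(xi), hence so does C, and T preserves null sets. Conversely, if x is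
   not in C, some basic open set B containing x is missed by M(xi) with positive
   probability, so by ergodicity almost every orbit visits an xi with M(xi)
   disjoint from B. The rest is deterministic: level-compactness gives cluster
   points to any sequence of points of E_n with g_n bounded above; these cluster
   points lie in C, and continuous convergence transfers upper bounds on g_n to
   g there. *)

Set Implicit Arguments.
Unset Strict Implicit.
Unset Printing Implicit Defensive.

Import Order.TTheory GRing.Theory Num.Theory.
Import numFieldNormedType.Exports.

Local Open Scope classical_set_scope.
Local Open Scope ring_scope.

(** * Continuous convergence and Painleve-Kuratowski limits *)

Section metric.
Context (R : realType) (X : metricType R).
Implicit Types (h : X -> \bar R) (C : set X) (S : (set X)^nat).
Local Open Scope ereal_scope.

(** One index [j] controls both the tail and the radius, so the points of bad pairs chosen along [j]
    converge to [x]. *)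
Lemma not_near2_witness (x : X) (Q : X -> nat -> Prop) :
  ~ (\forall y \near x & n \near \oo, Q y n) ->
  forall j : nat, exists p : nat * X,
    [/\ (j <= p.1)%N, ball x j.+1%:R^-1%R p.2 & ~ Q p.2 p.1].
Proof.
move=> nQ j; apply: contrapT => nE; apply: nQ.
exists (ball x j.+1%:R^-1%R, [set n | (j <= n)%N]) => /=.
  split; last by exists j.
  by apply: nbhsx_ballx; rewrite invr_gt0 ltr0n.
move=> [y n] /= [xy jn]; apply: contrapT => nQ.
by apply: nE; exists (n, y).
Qed.

(* A failure of the conclusion yields bad pairs (n_k, y_k) with n_k increasing
   and y_k --> x; the sequence equal to y_k at n_k and to x elsewhere converges
   to x. *)
Lemma converges_continuously_near (h_ : nat -> X -> \bar R) h :
  converges_continuously h_ h ->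
  forall (x : X) (V : set (\bar R)), nbhs (h x) V ->
    \forall y \near x & n \near \oo, V (h_ n y).
Proof.
move=> hc x V Vhx; apply: contrapT => nV.
have /choice[f fP] := not_near2_witness nV.
(* Restarting [f] just above the previous index makes the indices strictly increase. *)
pose p k := iter k (fun q => f q.1.+1) (f 0%N).
have pS k : p k.+1 = f (p k).1.+1 by [].
have p_lt k : ((p k).1 < (p k.+1).1)%N by rewrite pS; have [] := fP (p k).1.+1.
have p_homo : {homo (fun k => (p k).1) : m n / (m < n)%N >-> (m < n)%N}.
  by apply: homo_ltn => //; exact: ltn_trans.
have p_ge k : (k <= (p k).1)%N.
  by elim: k => // k IH; exact: leq_ltn_trans IH (p_lt k).
have p_ball k : ball x k.+1%:R^-1%R (p k).2.
  case: k => [|k]; first by have [] := fP 0%N.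
  rewrite pS; have [_ + _] := fP (p k).1.+1; apply: le_ball.
  by rewrite lef_pV2 ?posrE ?ltr0n// ler_nat !ltnS.
have p_bad k : ~ V (h_ (p k).1 (p k).2).
  by case: k => [|k]; [have [] := fP 0%N|rewrite pS; have [] := fP (p k).1.+1].
have p_inj : injective (fun k => (p k).1).
  move=> k l /= kl; case: (ltngtP k l) => // /p_homo; by rewrite /= kl ltnn.
pose z n := if pselect (exists k, (p k).1 = n) is left e
  then (p (sval (cid e))).2 else x.
have zp k : z (p k).1 = (p k).2.
  rewrite /z; case: pselect => [e|[]]; last by exists k.
  by case: cid => l /= /p_inj ->.
have zx : z @ \oo --> x.
  apply/cvg_ballP => e e0.
  have [K _ Ke] : \forall k \near \oo, (k.+1%:R^-1 < e)%R.
    by exact: (near_infty_natSinv_lt (PosNum e0)).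
  (* If [n] is the k-th index and is at least the K-th, monotonicity gives K <= k, so the radius
     1/(k+1) is below [e]. *)
  exists (p K).1 => // n /= Kn.
  have [[k kn]|nn] := pselect (exists k, (p k).1 = n).
    rewrite -kn zp; apply: le_ball (p_ball k); apply/ltW/Ke => /=.
    rewrite leqNgt; apply/negP => /p_homo /=; by rewrite kn ltnNge Kn.
  by rewrite /z; case: pselect => // _; exact: ballxx.
have [N _ NV] := hc x z zx V Vhx.
by apply: (@p_bad N); rewrite -zp; apply: NV => /=; exact: p_ge.
Qed.

Lemma dist_to_ge0 (x : X) C : 0 <= dist_to x C.
Proof. by apply: le_ereal_inf_tmp => _ [y _ <-]; rewrite lee_fin mdist_ge0. Qed.

Lemma lt_ereal_mid (a b : \bar R) : a < b -> exists r : R, a < r%:E < b.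
Proof.
case: a b => [a| |] [b| |]//=.
- rewrite lte_fin => ab; exists ((a + b) / 2)%R.
  by rewrite !lte_fin (midf_lt ab).1 (midf_lt ab).2.
- by exists (a + 1)%R; rewrite lte_fin ltrDl ltr01 ltry.
- by exists (b - 1)%R; rewrite lte_fin gtrBl ltr01 ltNyr.
- by exists 0%R; rewrite ltNyr ltry.
Qed.

Lemma limn_einfE (u : (\bar R)^nat) :
  limn_einf u = ereal_sup (range (einfs u)).
Proof.
by rewrite limn_einf_lim; apply: cvg_lim => //; exact: cvg_einfs_sup.
Qed.

(** This filter form combines directly with [converges_continuously_near] and with near-covering
    compactness. A positive liminf of distances keeps some ball around [x] away from all late [S n],
    and conversely. *)
Lemma pk_limsupP S (x : X) :
  pk_limsup S x <-> ~ (\forall y \near x & n \near \oo, ~ S n y).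
Proof.
rewrite /pk_limsup/= limn_einfE.
set u := fun n => dist_to x (S n); split => [s0 [[A B] /= [Ax [N _ NB]] AB]|nS].
  have /nbhs_ballP[e /= e0 eA] := Ax.
  suff : e%:E <= 0 by rewrite lee_fin leNgt e0.
  rewrite -s0; apply: (@le_trans _ _ (einfs u N)); last first.
    by apply: ereal_sup_ubound; exists N.
  apply: le_ereal_inf_tmp => _ /= [n Nn <-].
  apply: le_ereal_inf_tmp => _ /= [y Sy <-].
  rewrite lee_fin leNgt; apply/negP => xy; apply: (AB (y, n)) => //=.
  by split; [apply: eA; rewrite ballEmdist|exact: NB].
apply/eqP; rewrite eq_le; apply/andP; split; last first.
  apply: (@le_trans _ _ (einfs u 0%N)); last first.
    by apply: ereal_sup_ubound; exists 0%N.
  by apply: le_ereal_inf_tmp => _ /= [n _ <-]; exact: dist_to_ge0.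
rewrite leNgt; apply/negP => /ereal_sup_gt[_ [N _ <-]] /lt_ereal_mid[e].
rewrite lte_fin => /andP[e0 eN]; apply: nS.
exists (ball x e, [set n | (N <= n)%N]) => /=.
  by split; [exact: nbhsx_ballx|exists N].
move=> [y n] /= [+ Nn] Sny; rewrite ballEmdist/= => xy.
suff : e%:E < (mdist x y)%:E by rewrite lte_fin ltNge ltW.
apply: (lt_le_trans eN); apply: (@le_trans _ _ (u n)).
  by apply: ereal_inf_lbound; exists n.
by apply: ereal_inf_lbound; exists y.
Qed.

Lemma pk_liminf_sub_limsup S : pk_liminf S `<=` pk_limsup S.
Proof.
move=> x; rewrite /pk_liminf /pk_limsup/= => s0; apply/eqP; rewrite eq_le.
rewrite -{1}s0 limn_einf_sup/= limn_einfE.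
apply: le_trans (ereal_sup_ubound _); last by exists 0%N.
by apply: le_ereal_inf_tmp => _ /= [n _ <-]; exact: dist_to_ge0.
Qed.

Lemma near_pk_liminf S (x : X) : (\forall n \near \oo, S n x) -> pk_liminf S x.
Proof.
move=> Sx; rewrite /pk_liminf/=.
apply: (cvg_limn_einf_sup _).2; apply: cvg_near_cst.
apply: filterS Sx => n Snx; apply/eqP; rewrite eq_le dist_to_ge0 andbT.
by apply: ereal_inf_lbound; exists x; rewrite ?mdistxx.
Qed.

(** Were [b < h x], joint nearness would give [b < h_ n y] for all [y] near [x] and all late [n], so
    such [y] would avoid [S n]. *)
Lemma le_pk_limsup (h_ : nat -> X -> \bar R) h S (x : X) (b : \bar R) :
  converges_continuously h_ h ->
  (\forall n \near \oo, forall y, S n y -> h_ n y <= b) ->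
  pk_limsup S x -> h x <= b.
Proof.
move=> hc Sb /pk_limsupP Sx; rewrite leNgt; apply/negP => bh; apply: Sx.
have [[A B] /= [Ax BN] AB] :=
  converges_continuously_near hc (open_ereal_gt' bh).
exists (A, B `&` [set n | forall y, S n y -> h_ n y <= b]) => /=.
  by split => //; exact: filterI.
move=> [y n] /= [Ay [Bn Sb']] /Sb'; apply/negP; rewrite -ltNge.
exact: (AB (y, n)).
Qed.

(* Compactness enters as near-covering, with the filter of cofinite sets as
   the parameter filter. *)
Lemma pk_limsup_nonempty S (K : set X) : compact K ->
  (\forall n \near \oo, S n `<=` K) ->
  ~ (\forall n \near \oo, S n = set0) -> pk_limsup S !=set0.
Proof.
move=> /compact_near_coveringP cK SK nS; apply: contrapT => S0; apply: nS.
have : \forall n \near \oo, K `<=` [set y | ~ S n y].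
  apply: cK => x _; apply: contrapT => nx; apply: S0; exists x.
  exact/pk_limsupP.
apply: filterS2 SK => n SK KS; rewrite -subset0 => y Sny.
exact: KS (SK _ Sny) Sny.
Qed.

(** If [x] is outside [E m], the complement of [E m] is a neighbourhood of [x] missed by every [S n]
    with m <= n. *)
Lemma pk_limsup_closed S (E : (set X)^nat) (x : X) :
  (forall n, closed (E n)) -> nonincreasing_seq E -> (forall n, S n `<=` E n) ->
  pk_limsup S x -> forall n, E n x.
Proof.
move=> cE dE SE /pk_limsupP Sx m; apply: contrapT => Emx; apply: Sx.
exists (~` E m, [set n | (m <= n)%N]) => /=.
  split; last by exists m.
  by apply: open_nbhs_nbhs; split => //; exact: closed_openC.
move=> [y n] /= [nE mn] /SE; apply: contra_not nE.
by have /subsetPset := dE _ _ mn; apply.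
Qed.

(** The threshold lies strictly above the infimum, even when the infimum is -oo, since -1/e is
    real. *)
Lemma eps_argmin_nonempty (e : R) h C : (0 < e)%R ->
  inf_on h C < +oo -> eps_argmin e h C !=set0.
Proof.
move=> e0 hC.
suff /ereal_inf_lt[_ [x Cx <-] hx] : inf_on h C < eps_val e h C.
  by exists x; split => //; exact: ltW.
rewrite /eps_val; case: eqP => [->|/eqP Ny].
  by rewrite inver gt_eqF// -EFinN ltNyr.
by rewrite lteDl// fin_numE Ny/= lt_eqF.
Qed.

(** The weak lower and strict upper bounds are those supplied by [near_inf_ge] and [near_inf_lt];
    halving [e] makes up for the weak one. *)
Lemma cvge_between (u : (\bar R)^nat) (l : R) :
  (forall a, a < l%:E -> \forall n \near \oo, a <= u n) ->
  (forall b, l%:E < b -> \forall n \near \oo, u n < b) ->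
  u @ \oo --> l%:E.
Proof.
move=> la lb V; rewrite /nbhs/= => -[e /= e0 eV].
near=> n.
have : (l - e / 2)%:E <= u n.
  by near: n; apply: la; rewrite lte_fin gtrBl divr_gt0.
have : u n < (l + e / 2)%:E.
  by near: n; apply: lb; rewrite lte_fin ltrDl divr_gt0.
case E : (u n) => [r| |] //; rewrite lte_fin lee_fin => rl lr.
rewrite /= E; apply: eV => /=; rewrite ltr_norml; apply/andP; split; lra.
Unshelve. all: by end_near. Qed.

End metric.

(** * Values and minimizers on nested closed sets, deterministically *)

Section nested_constraints.
Context (R : realType) (X : metricType R).
Variables (g_ : nat -> X -> \bar R) (g : X -> \bar R).
Variables (E : (set X)^nat) (C : set X).
Hypothesis gNy : no_ninfty g.
Hypothesis cvgg : converges_continuously g_ g.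
Hypothesis clE : forall n, closed (E n).
Hypothesis dE : nonincreasing_seq E.
Hypothesis capE : \bigcap_n E n = C.
Hypothesis feas : exists2 x, C x & (g x < +oo)%E.
Hypothesis elc : eventually_level_compact g_ E.
Implicit Types (S : (set X)^nat) (e : R).
Local Open Scope ereal_scope.

Let sub_capE n : C `<=` E n. Proof. by rewrite -capE; exact: bigcap_inf. Qed.

Let inf_lty : inf_on g C < +oo.
Proof.
have [x Cx gx] := feas.
by apply: le_lt_trans gx; apply: ereal_inf_lbound; exists x.
Qed.

Let cvg_pt x : g_ n x @[n --> \oo] --> g x.
Proof. by apply: (cvgg (x_ := fun=> x)); exact: cvg_cst. Qed.

(** A point of [C] with value below [b] lies in every [E n], and [g_] converges there. *)
Lemma near_inf_lt (b : \bar R) :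
  inf_on g C < b -> \forall n \near \oo, inf_on (g_ n) (E n) < b.
Proof.
move=> /ereal_inf_lt[_ [x Cx <-] gxb].
have : \forall n \near \oo, g_ n x < b.
  exact: (cvg_pt (open_ereal_lt' gxb)).
apply: filterS => n; apply: le_lt_trans; apply: ereal_inf_lbound.
by exists x => //; exact: sub_capE.
Qed.

Lemma sub_pk_limsup S : (forall n, S n `<=` E n) -> pk_limsup S `<=` C.
Proof.
by move=> SE x Sx; rewrite -capE => n _; exact: (pk_limsup_closed clE dE SE Sx).
Qed.

(** Level-compactness at the single level [a] confines all late [S n] to one compact set. *)
Lemma pk_limsup_level_nonempty S (a : R) : (forall n, S n `<=` E n) ->
  (\forall n \near \oo, forall y, S n y -> g_ n y <= a%:E) ->
  ~ (\forall n \near \oo, S n = set0) -> pk_limsup S !=set0.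
Proof.
move=> SE Sa; have [N [K NK [cK _]]] := elc a.
apply: (pk_limsup_nonempty cK).
apply: filterS2 Sa (nbhs_infty_ge N) => n Sa Nn y Sy.
by apply: NK; exists n => //; split; [exact: SE|exact: Sa].
Qed.

(** Otherwise the sublevel sets at [a] are nonempty for arbitrarily large [n] and have a cluster
    point; it lies in [C] with [g] at most [a], below the infimum. *)
Lemma near_inf_ge (a : \bar R) :
  a < inf_on g C -> \forall n \near \oo, a <= inf_on (g_ n) (E n).
Proof.
move=> ag; have aoo : a < +oo by exact: lt_trans inf_lty.
case: a ag aoo => [a| |] ag aoo //; last by apply: nearW => n; rewrite leNye.
pose S n := [set y | E n y /\ g_ n y <= a%:E].
have SE n : S n `<=` E n by move=> y [].
have Sa : \forall n \near \oo, forall y, S n y -> g_ n y <= a%:E.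
  by apply: nearW => n y [].
have [S0|] := pselect (\forall n \near \oo, S n = set0).
  apply: filterS S0 => n S0; apply: le_ereal_inf_tmp => _ [y Ey <-].
  rewrite leNgt; apply/negP => ga.
  have : S n y by split => //; exact: ltW.
  by rewrite S0.
move=> /(pk_limsup_level_nonempty SE Sa)[x Sx].
have := le_pk_limsup cvgg Sa Sx; rewrite leNgt => /negP[].
apply: lt_le_trans ag _; apply: ereal_inf_lbound; exists x => //.
exact: (sub_pk_limsup SE).
Qed.

(** Finiteness of the infimum over [C] is not yet known here, so the -oo branch of [eps_val] must be
    bounded too. *)
Lemma near_eps_val_le (eps : nat -> R) (b : R) :
  (forall n, 0 < eps n)%R -> eps n @[n --> \oo] --> (0 : R)%R ->
  inf_on g C < b%:E ->
  \forall n \near \oo, eps_val (eps n) (g_ n) (E n) <= b%:E.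
Proof.
move=> eps0 epsc /lt_ereal_mid[c /andP[gc]]; rewrite lte_fin => cb.
have := near_inf_lt gc.
(* The bound [b - c] serves the branch of infimum above -oo; the bound 1/(|b|+1) serves the other,
   as then -1/eps < -(|b|+1) <= b. *)
have e1 : \forall n \near \oo, (eps n < b - c)%R.
  by apply: (cvgr_lt _ epsc); rewrite subr_gt0.
have e2 : \forall n \near \oo, (eps n < (`|b| + 1)^-1)%R.
  by apply: (cvgr_lt _ epsc); rewrite invr_gt0 ltr_wpDl.
apply: filterS3 e1 e2 => n e1 e2 nc; rewrite /eps_val; case: eqP => [_|_].
  rewrite inver gt_eqF// -EFinN lee_fin lerNl.
  apply: (@le_trans _ _ (`|b| + 1)%R).
    by rewrite -normrN ler_wpDr// ler_norm.
  by rewrite -[leLHS]invrK lef_pV2 ?posrE ?invr_gt0 ?ltr_wpDl// ltW.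
apply: (@le_trans _ _ (c%:E + (b - c)%:E)); last by rewrite -EFinD subrKC.
by apply: leeD; [exact: ltW|rewrite lee_fin ltW].
Qed.

(** On the approximate argmin sets, [g_ n] is eventually at most any real [b] above the infimum. One
    such [b] gives a cluster point; all of them together bound [g] at each cluster point by the
    infimum. *)
Lemma pk_limsup_eps_argmin (eps : nat -> R) :
  (forall n, 0 < eps n)%R -> eps n @[n --> \oo] --> (0 : R)%R ->
  let L := pk_limsup (fun n => eps_argmin (eps n) (g_ n) (E n)) in
  L !=set0 /\ L `<=` argmin g C.
Proof.
move=> eps0 epsc; set S := fun n => _; rewrite /=.
have SE n : S n `<=` E n by move=> y [].
have Sb (b : R) : inf_on g C < b%:E ->
    \forall n \near \oo, forall y, S n y -> g_ n y <= b%:E.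
  move=> /(near_eps_val_le eps0 epsc).
  by apply: filterS => n nb y [_ /le_trans]; apply.
split.
  have [b /andP[gb _]] := lt_ereal_mid inf_lty.
  apply: (pk_limsup_level_nonempty SE (Sb _ gb)) => S0.
  have S1 : \forall n \near \oo, S n !=set0.
    by apply: filterS (near_inf_lt inf_lty) => n; exact: eps_argmin_nonempty.
  have [n [Sn0 [x]]] := filter_ex (filterI S0 S1).
  by rewrite Sn0.
move=> x Sx; rewrite argminE; split; first exact: sub_pk_limsup Sx.
rewrite leNgt; apply/negP => /lt_ereal_mid[b /andP[gb]].
by rewrite ltNge => /negP; apply; exact: (le_pk_limsup cvgg (Sb _ gb)).
Qed.

(** Tolerances 1/(n+1) produce a minimizer of [g] over [C], and [g] is above -oo there. *)
Lemma inf_on_fin_num : inf_on g C \is a fin_num.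
Proof.
have [|[x Lx] /(_ x Lx)] := @pk_limsup_eps_argmin (fun n => n.+1%:R^-1%R) _
  (cvg_harmonic (R := R)).
  by move=> n; rewrite invr_gt0 ltr0n.
rewrite argminE => -[_ gx]; rewrite fin_numElt inf_lty andbT.
exact: lt_le_trans gx.
Qed.

Lemma cvg_val_min : val_min (g_ n) (E n) @[n --> \oo] --> val_min g C.
Proof.
under eq_fun do rewrite val_minE.
rewrite val_minE -(fineK inf_on_fin_num).
apply: cvge_between => ?; rewrite (fineK inf_on_fin_num).
  exact: near_inf_ge.
exact: near_inf_lt.
Qed.

(** A minimizer is itself eventually an e-minimizer: half of [e] absorbs the error of [g_ n] at it,
    half that of the infimum over [E n]. *)
Lemma argmin_sub_pk_liminf e : (0 < e)%R ->
  argmin g C `<=` pk_liminf (fun n => eps_argmin e (g_ n) (E n)).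
Proof.
move=> e0 x; rewrite argminE => -[Cx gx]; apply: near_pk_liminf.
have gf := inf_on_fin_num; set r := fine (inf_on g C).
have rE : inf_on g C = r%:E by rewrite fineK.
have e20 : (0 < e / 2)%R by rewrite divr_gt0.
have lo : \forall n \near \oo, (r - e / 2)%:E <= inf_on (g_ n) (E n).
  by apply: near_inf_ge; rewrite rE lte_fin gtrBl.
have up : \forall n \near \oo, g_ n x < (r + e / 2)%:E.
  have gxr : g x < (r + e / 2)%:E.
    by apply: le_lt_trans gx _; rewrite rE lte_fin ltrDl.
  exact: (cvg_pt (open_ereal_lt' gxr)).
apply: filterS2 lo up => n lo up; split; first exact: sub_capE.
have Ny : inf_on (g_ n) (E n) != -oo.
  by rewrite gt_eqF// (lt_le_trans _ lo)// ltNyr.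
rewrite /eps_val (negbTE Ny); apply: (le_trans (ltW up)).
have -> : (r + e / 2)%:E = (r - e / 2)%:E + e%:E.
  by rewrite -EFinD; congr EFin; lra.
exact: leeD.
Qed.

Lemma pk_limsup_sub_argmin :
  \bigcap_(e in [set e | (0 < e)%R])
    pk_limsup (fun n => eps_argmin e (g_ n) (E n)) `<=` argmin g C.
Proof.
move=> x Lx; rewrite argminE; split.
  by apply: sub_pk_limsup (Lx 1%R ltr01) => n y [].
set r := fine (inf_on g C).
have rE : inf_on g C = r%:E by rewrite fineK// inf_on_fin_num.
rewrite rE; apply/lee_addgt0Pr => e e0.
have e20 : (0 < e / 2)%R by rewrite divr_gt0.
(* Half of [e] is the argmin tolerance, the other half the error of the infimum over [E n]. *)
apply: le_pk_limsup cvgg _ (Lx _ e20).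
have lo : \forall n \near \oo, (r - e / 2)%:E <= inf_on (g_ n) (E n).
  by apply: near_inf_ge; rewrite rE lte_fin gtrBl.
have up : \forall n \near \oo, inf_on (g_ n) (E n) < (r + e / 2)%:E.
  by apply: near_inf_lt; rewrite rE lte_fin ltrDl.
apply: filterS2 lo up => n lo up y [_ /le_trans]; apply.
have Ny : inf_on (g_ n) (E n) != -oo.
  by rewrite gt_eqF// (lt_le_trans _ lo)// ltNyr.
rewrite /eps_val (negbTE Ny).
have -> : r%:E + e%:E = (r + e / 2)%:E + (e / 2)%:E.
  by rewrite -!EFinD; congr EFin; lra.
by apply: leeD => //; exact: ltW.
Qed.

(** Three inclusions close a cycle: inner limits, outer limits, argmin. *)
Lemma bigcap_pk_lim_eps_argmin :
  \bigcap_(e in [set e : R | (0 < e)%R])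
      pk_liminf (fun n => eps_argmin e (g_ n) (E n)) = argmin g C /\
  argmin g C = \bigcap_(e in [set e : R | (0 < e)%R])
      pk_limsup (fun n => eps_argmin e (g_ n) (E n)).
Proof.
set I := \bigcap_(_ in _) pk_liminf _; set L := \bigcap_(_ in _) pk_limsup _.
have IL : I `<=` L by move=> x Ix e e0; exact/pk_liminf_sub_limsup/Ix.
have aI : argmin g C `<=` I by move=> x ax e e0; exact: argmin_sub_pk_liminf.
have La : L `<=` argmin g C := pk_limsup_sub_argmin.
split; apply/seteqP; split => //; first exact: subset_trans La.
exact: subset_trans IL.
Qed.

End nested_constraints.

(** * Iterates and recurrence of an ergodic map *)

Section recurrence.
Context d (Xi : measurableType d) (R : realType) (P : probability Xi R).
Variable T : Xi -> Xi.

Lemma measurable_preimage_iter (A : set Xi) (k : nat) :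
  measurable_fun setT T -> measurable A -> measurable (iter k T @^-1` A).
Proof.
move=> mT mA; elim: k => // k IH.
have -> : iter k.+1 T @^-1` A = T @^-1` (iter k T @^-1` A).
  by apply/seteqP; split => x /=; rewrite -iterSr.
by rewrite -[X in measurable X]setTI; exact: mT.
Qed.

Lemma measure_preserving_iter (A : set Xi) (k : nat) :
  measure_preserving P T -> measurable A -> P (iter k T @^-1` A) = P A.
Proof.
move=> [mT pT] mA; elim: k => // k IH.
have -> : iter k.+1 T @^-1` A = T @^-1` (iter k T @^-1` A).
  by apply/seteqP; split => x /=; rewrite -iterSr.
by rewrite pT//; exact: measurable_preimage_iter.
Qed.

Lemma ae_preimage_iter (Q : Xi -> Prop) (k : nat) : measure_preserving P T ->
  (\forall x \ae P, Q x) -> \forall x \ae P, Q (iter k T x).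
Proof.
move=> mpT [A [mA PA QA]]; exists (iter k T @^-1` A); split.
- by apply: measurable_preimage_iter => //; case: mpT.
- by rewrite measure_preserving_iter.
- by move=> x /= nQ; apply: QA.
Qed.

(* The set of points visiting [A] infinitely often is invariant and has
   measure at least [P A]. *)
Lemma ergodic_visit (A : set Xi) :
  measure_preserving P T -> ergodic P T -> measurable A -> P A != 0%E ->
  \forall x \ae P, exists2 k, (1 <= k)%N & A (iter k T x).
Proof.
move=> mpT [mT eT] mA PA0; pose F k := iter k T @^-1` A.
have mF k : measurable (F k) by exact: measurable_preimage_iter.
pose B := lim_sup_set F.
have mB : measurable B.
  apply: bigcap_measurable => // n _.
  by apply: bigcup_measurable => k _; exact: mF.
have BT : B = T @^-1` B.
  apply/seteqP; split => x /= Bx n _.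
    (* A visit at time at least n+1 has nonzero time, so one [T] can be peeled off. *)
    have [k /= nk] := Bx n.+1 I.
    case: k nk => // k nk Fx; exists k => //.
    by rewrite /F/= -iterSr.
  have [k /= nk Fx] := Bx n I; exists k.+1; first exact: leqW.
  by rewrite /F/= -iterS iterSr.
(* Each tail union contains a preimage of [A], of measure [P A], and the tail unions decrease to
   [B]. *)
have PB : (P A <= P B)%E.
  have c := lim_sup_set_cvg P F mF.
  apply: (cvge_ge _ (c _)).
    near=> n; rewrite -(@measure_preserving_iter A n mpT mA).
    apply: le_measure; rewrite ?inE//; first exact: mF.
      by apply: bigcup_measurable => k _; exact: mF.
    by move=> x Ax; exists n => /=.
  apply: le_lt_trans (ltry 1); apply: probability_le1.
  by apply: bigcup_measurable => k _; exact: mF.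
case: (eT B mB BT) => PB0.
  by move: PB; rewrite PB0 measure_le0 (negbTE PA0).
exists (~` B); split => //; first exact: measurableC.
by move=> x /= nA Bx; apply: nA; have [k /= k1 Fx] := Bx 1%N I; exists k.
Unshelve. all: by end_near. Qed.

End recurrence.

(** * A countable base from a countable dense set *)

Section separable_metric.
Context (R : realType) (X : metricType R).

Lemma separable_ball_basis : separable X -> [set: X] !=set0 ->
  exists B : nat -> set X, (forall i, open (B i)) /\
    forall x A, nbhs x A -> exists2 i, B i x & B i `<=` A.
Proof.
move=> [D cD dD] [x0 _].
have /countable_injP[f finj] := cD.
(* A left inverse of the coding [f] of [D], with default [x0] at numbers coding no point. *)
pose u n := xget x0 [set y | D y /\ f y = n].
have uf y : D y -> u (f y) = y.
  move=> Dy; rewrite /u; case: xgetP => [z _ [Dz fz]|/(_ y) []//].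
  by apply: finj => //; exact/mem_set.
(* Interiors make openness immediate; the radius is a sum to match the triangle inequality. *)
pose B i := if unpickle i is Some p
  then (ball (u p.1) (p.2.+1%:R^-1 + p.2.+1%:R^-1))° else set0.
exists B; split=> [i|x A /nbhs_ballP[e /= e0 eA]].
  by rewrite /B; case: unpickle => [p|]; [exact: open_interior|exact: open0].
(* The center is within r of [x] and the basic ball has radius 2r, so 3r must stay below [e]. *)
have e3 : 0 < e / 3 by rewrite divr_gt0.
have [n _ /(_ n (leqnn n)) /= ne] := near_infty_natSinv_lt (PosNum e3).
pose r : R := n.+1%:R^-1.
have r0 : 0 < r by rewrite invr_gt0 ltr0n.
have [y [/interior_subset xy Dy]] : (ball x r)° `&` D !=set0.
  apply: dD; last exact: open_interior.
  by exists x; exact: nbhsx_ballx.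
exists (pickle (f y, n)); rewrite /B pickleK/= uf//.
  apply: filterS (nbhsx_ballx x r r0) => z; exact/ball_triangle/ball_sym.
move=> z /interior_subset /(ball_triangle xy) xz; apply: eA.
by apply: le_ball xz; rewrite -/r; move: ne; rewrite -/r; lra.
Qed.


End separable_metric.

(** * Almost sure intersection of the sampled sets *)

Section sampled_constraints.
Context (R : realType) (X : metricType R) d (Xi : measurableType d).
Context (P : probability Xi R).
Variables (M : Xi -> set X) (T : Xi -> Xi).
Hypothesis sepX : separable X.
Hypothesis mM : measurable_multifunction M.
Hypothesis clM : forall xi, closed (M xi).
Hypothesis mpT : measure_preserving P T.
Hypothesis ergT : ergodic P T.

Let Mas := almost_sure_set M P.

Lemma closed_sampled_set xi n : closed (sampled_set M T xi n).
Proof. by apply: closed_bigI => k _; exact: clM. Qed.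

Lemma nonincreasing_sampled_set xi : nonincreasing_seq (sampled_set M T xi).
Proof.
move=> m n mn; apply/subsetPset => x Ex k /= /andP[k1 km].
by apply: Ex; rewrite /= k1 (leq_trans km).
Qed.

Lemma ae_bigcap_sampled_set : [set: X] !=set0 ->
  \forall xi \ae P, \bigcap_n sampled_set M T xi n = Mas.
Proof.
move=> X0; have [B [oB bB]] := separable_ball_basis sepX X0.
have clB xi x : (forall i, B i x -> M xi `&` B i !=set0) -> M xi x.
  move=> MB; have -> : M xi = closure (M xi) by exact/closure_id.
  move=> A /bB[i Bx BA]; have [y [My By]] := MB i Bx.
  by exists y; split => //; exact: BA.
(* It suffices to test one point of [Mas] in each basic set meeting it; these are countably many, so
   a single null set is discarded. *)
have sub_ae : \forall xi \ae P, Mas `<=` M xi.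
  have : \forall xi \ae P, forall i, Mas `&` B i !=set0 -> M xi `&` B i !=set0.
    apply: ae_foralln => i.
    have [[x [Mx Bx]]|MB] := pselect (Mas `&` B i !=set0).
      by apply: filterS Mx => xi Mx _; exists x.
    by apply: nearW => xi /MB.
  apply: filterS => xi MB x Mx; apply: clB => i Bx.
  by apply: MB; exists x.
pose miss i := [set xi | M xi `&` B i = set0].
have mmiss i : measurable (miss i).
  have -> : miss i = ~` [set xi | M xi `&` B i !=set0].
    by apply/seteqP; split => xi /nonemptyPn.
  by apply: measurableC; exact: mM.
have miss_ae : \forall xi \ae P, forall i,
    P (miss i) = 0%E \/ exists2 k, (1 <= k)%N & miss i (iter k T xi).
  apply: ae_foralln => i.
  have [Pi|/eqP Pi] := pselect (P (miss i) = 0%E).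
    by apply: nearW => xi; left.
  by have := ergodic_visit mpT ergT (mmiss i) Pi; apply: filterS => xi; right.
have sub_iter : \forall xi \ae P, forall k, Mas `<=` M (iter k T xi).
  by apply: ae_foralln => k; exact: (ae_preimage_iter k mpT sub_ae).
apply: filterS2 sub_iter miss_ae => xi subM mxi; apply/seteqP; split.
  move=> x Ex; apply: contrapT => nMx.
  suff [i Bx Pi] : exists2 i, B i x & P (miss i) != 0%E.
    have [/eqP|[k k1 mk]] := mxi i; first by rewrite (negbTE Pi).
    suff : set0 x by [].
    by rewrite -mk; split => //; apply: (Ex k) => //=; rewrite k1 leqnn.
  (* If every basic set around [x] were missed with probability zero, almost every value of [M]
     would meet them all and contain [x] by closedness. *)
  apply: contrapT => nB; apply: nMx.
  have : \forall xi \ae P, forall i, B i x -> ~ miss i xi.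
    apply: ae_foralln => i.
    have [Bx|nBx] := pselect (B i x); last by apply: nearW.
    exists (miss i); split => //; last by move=> zi /= /not_implyP[_ /contrapT].
    by apply/eqP; apply: contrapT => /negP Pi; apply: nB; exists i.
  by apply: filterS => zi mz; apply: clB => i /mz/eqP/set0P.
by move=> x Mx n _ k _; exact: subM.
Qed.

End sampled_constraints.

(** * Transfer of the deterministic results to almost every sample *)

Theorem corollary3p1 (R : realType) (X : completeMetricType R)
    (d : measure_display) (Xi : measurableType d) (P : probability Xi R)
    (M : Xi -> set X) (T : Xi -> Xi)
    (g : X -> \bar R) (g_ : nat -> X -> \bar R)
    (sepX : separable X)
    (cP : measure_is_complete P)
    (mM : measurable_multifunction M)
    (clM : forall xi, closed (M xi))
    (mpT : measure_preserving P T)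
    (ergT : ergodic P T)
    (gNy : no_ninfty g)
    (lscg : lower_semicontinuous g)
    (g_Ny : forall n, no_ninfty (g_ n))
    (lscg_ : forall n, lower_semicontinuous (g_ n))
    (cvgg : converges_continuously g_ g)
    (feas : exists2 x, almost_sure_set M P x & (g x < +oo)%E)
    (elc : \forall xi \ae P,
      eventually_level_compact g_ (sampled_set M T xi)) :
  [/\ \forall xi \ae P,
        val_min (g_ n) (sampled_set M T xi n) @[n --> \oo]
          --> val_min g (almost_sure_set M P),
      forall eps : nat -> Xi -> R,
        (forall n, measurable_fun [set: Xi] (eps n)) ->
        (forall n xi, 0 < eps n xi) ->
        (\forall xi \ae P, eps n xi @[n --> \oo] --> (0 : R)) ->
        \forall xi \ae P,
          let L := pk_limsup (fun n =>
            eps_argmin (eps n xi) (g_ n) (sampled_set M T xi n)) in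
          L !=set0 /\ L `<=` argmin g (almost_sure_set M P)
    & \forall xi \ae P,
        \bigcap_(e in [set e : R | 0 < e]) pk_liminf (fun n =>
            eps_argmin e (g_ n) (sampled_set M T xi n))
          = argmin g (almost_sure_set M P) /\
        argmin g (almost_sure_set M P)
          = \bigcap_(e in [set e : R | 0 < e]) pk_limsup (fun n =>
            eps_argmin e (g_ n) (sampled_set M T xi n))].
Proof.
have X0 : [set: X] !=set0 by have [x _ _] := feas; exists x.
have capE := ae_bigcap_sampled_set sepX mM clM mpT ergT X0.
have clE := closed_sampled_set (T := T) clM.
have dE := @nonincreasing_sampled_set _ X _ Xi M T.
split.
- apply: filterS2 capE elc => xi cE lc.
  exact: (cvg_val_min gNy cvgg (clE xi) (dE xi) cE feas lc).
- move=> eps _ eps0 epsc; apply: filterS3 capE elc epsc => xi cE lc ec.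
  by apply: (pk_limsup_eps_argmin cvgg (clE xi) (dE xi) cE feas lc).
- apply: filterS2 capE elc => xi cE lc.
  exact: (bigcap_pk_lim_eps_argmin gNy cvgg (clE xi) (dE xi) cE feas lc).
Qed.
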